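(* Let $n\geqslant 4$ and let $M$ be a $2\times 2$ Griffiths positive matrix of constant coefficient $(1,1)$-forms on $\mathbb{C}^n$ with diagonalized entries. Then $\Omega=\det(M)$ is a Lefschetz form for the bidegrees $(n-2,0)$, $(n-3,1)$, $(1,n-3)$ and $(0,n-2)$.
   Context: $V^{p,q}$ is the space of constant coefficient $(p,q)$-forms on $\mathbb{C}^n$. A $(1,1)$-form is Kähler if it equals $\sum_l\frac{\sqrt{-1}}{2}dw_l\wedge d\overline{w_l}$ in some complex linear coordinates. A matrix $M=(\alpha_{i,j})$ of $(1,1)$-forms with $\alpha_{i,j}=\overline{\alpha_{j,i}}$ is Griffiths positive if $\sum_{i,j}\theta_i\alpha_{i,j}\overline{\theta_j}$ is Kähler for every nonzero $\theta$. $M$ has diagonalized entries if in some complex linear coordinates $(z_l)$ every entry is $\sum_l b_{i,j}^{(l)}\frac{\sqrt{-1}}{2}dz_l\wedge d\overline{z_l}$. $\det(M)=\alpha_{1,1}\wedge\alpha_{2,2}-\alpha_{1,2}\wedge\alpha_{2,1}$. $\Omega\in V^{2,2}$ is a Lefschetz form for bidegree $(p,q)$, $p+q=n-2$, if $\alpha\mapsto\alpha\wedge\Omega$ is an isomorphism $V^{p,q}\to V^{n-q,n-p}$. *)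

(* Defs.v *)
(* Constant-coefficient complex differential forms on C^n,
   modelled as the exterior algebra on the 2n generators
   dz_0..dz_{n-1} (ordinals lshift n k) and dzbar_0..dzbar_{n-1}
   (ordinals rshift n k) of 'I_(n+n).  A form is the family of its
   coefficients on the basis e_S = wedge of the generators in S in increasing
   order.  Coefficients live in an arbitrary numClosedFieldType C
   (e.g. the complex numbers). *)
From HB Require Import structures.
From mathcomp Require Import all_boot all_order all_algebra.
Set Implicit Arguments. Unset Strict Implicit. Unset Printing Implicit Defensive.
Import Order.TTheory GRing.Theory Num.Theory.
Local Open Scope ring_scope.

(* the type of forms with coefficients in C on C^n *)
Notation form_t C n := {ffun {set 'I_(n + n)} -> C^o} (only parsing).

Section Forms.
Variables (C : numClosedFieldType) (n : nat).

Local Notation form := (form_t C n) (only parsing).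

(* holomorphic / antiholomorphic generators *)
Definition dzi (k : 'I_n) : 'I_(n + n) := lshift n k.
Definition dzbi (k : 'I_n) : 'I_(n + n) := rshift n k.

(* basis element e_S *)
Definition fbasis (S : {set 'I_(n + n)}) : form := [ffun T => (T == S)%:R].

(* sign of e_A /\ e_B = sgn * e_(A u B) for disjoint A B: number of inversions *)
Definition wsign (A B : {set 'I_(n + n)}) : C :=
  (-1) ^+ #|[set p : 'I_(n + n) * 'I_(n + n) |
              [&& p.1 \in A, p.2 \in B & (p.2 < p.1)%N]]|.

Definition wedge (f g : form) : form :=
  [ffun S => \sum_(A : {set 'I_(n + n)}) \sum_(B : {set 'I_(n + n)})
      if (A :|: B == S) && [disjoint A & B]
      then wsign A B * f A * g B else 0].

Definition form1 : form := fbasis set0.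
Definition gen (x : 'I_(n + n)) : form := fbasis [set x].
Definition dz (k : 'I_n) : form := gen (dzi k).
Definition dzb (k : 'I_n) : form := gen (dzbi k).

(* wedge product of generators listed in order *)
Definition wedge_list (l : seq 'I_(n + n)) : form :=
  foldr (fun x acc => wedge (gen x) acc) form1 l.

(* generator swap dz_k <-> dzbar_k *)
Definition swapgen (x : 'I_(n + n)) : 'I_(n + n) :=
  match split x with inl k => dzbi k | inr k => dzi k end.

(* complex conjugation of forms: conj (c e_S) = conj(c) * conj of the
   ordered wedge of generators of S *)
Definition fconj (f : form) : form :=
  \sum_(S : {set 'I_(n + n)}) ((f S)^* *: wedge_list (map swapgen (enum S))).

(* holomorphic and antiholomorphic parts of an index set *)
Definition hol_part (S : {set 'I_(n + n)}) := [set k : 'I_n | dzi k \in S].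
Definition ahol_part (S : {set 'I_(n + n)}) := [set k : 'I_n | dzbi k \in S].

(* f belongs to V^{p,q} *)
Definition is_pq (p q : nat) (f : form) : Prop :=
  forall S, f S != 0 -> #|hol_part S| = p /\ #|ahol_part S| = q.

(* the 1-form dw for linear coordinates w = A z, i.e. w_l = sum_k A l k z_k *)
Definition dw (A : 'M[C]_n) (l : 'I_n) : form := \sum_k (A l k *: dz k).

(* sqrt(-1)/2 dw_l /\ conj(dw_l) *)
Definition kahler_term (A : 'M[C]_n) (l : 'I_n) : form :=
  ('i / 2%:R) *: wedge (dw A l) (fconj (dw A l)).

(* Kähler (1,1)-form: standard form in some complex linear coordinates *)
Definition is_kahler (w : form) : Prop :=
  exists A : 'M[C]_n, A \in unitmx /\ w = \sum_l kahler_term A l.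

(* 2x2 matrices of (1,1)-forms, hermitian, Griffiths positive *)
Definition griffiths_positive (M : 'I_2 -> 'I_2 -> form) : Prop :=
  (forall i j, is_pq 1 1 (M i j)) /\
  (forall i j, M i j = fconj (M j i)) /\
  (forall theta : 'I_2 -> C, (exists i, theta i != 0) ->
     is_kahler (\sum_i \sum_j ((theta i * (theta j)^*) *: M i j))).

(* diagonalized entries: in some complex linear coordinates w = A z every
   entry is sum_l b_{ij}^{(l)} sqrt(-1)/2 dw_l /\ dwbar_l *)
Definition diagonalized (M : 'I_2 -> 'I_2 -> form) : Prop :=
  exists (A : 'M[C]_n) (b : 'I_2 -> 'I_2 -> 'I_n -> C),
    A \in unitmx /\ forall i j, M i j = \sum_l (b i j l *: kahler_term A l).

Definition det2 (M : 'I_2 -> 'I_2 -> form) : form :=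
  wedge (M 0 0) (M 1 1) - wedge (M 0 1) (M 1 0).

(* Lefschetz form for bidegree (p,q), p+q = n-2:
   alpha |-> alpha /\ Omega is a bijection V^{p,q} -> V^{n-q,n-p} *)
Definition lefschetz (Om : form) (p q : nat) : Prop :=
  (p + q = n - 2)%N /\
  (forall a : form, is_pq p q a -> is_pq (n - q) (n - p) (wedge a Om)) /\
  (forall a a' : form, is_pq p q a -> is_pq p q a' ->
      wedge a Om = wedge a' Om -> a = a') /\
  (forall b : form, is_pq (n - q) (n - p) b ->
      exists a : form, is_pq p q a /\ wedge a Om = b).

End Forms.

(* Main.v *)
Require Import Defs.
From HB Require Import structures.
From mathcomp Require Import all_boot all_order all_algebra.
From mathcomp Require Import ring zify.
Set Implicit Arguments. Unset Strict Implicit. Unset Printing Implicit Defensive.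
Import Order.TTheory GRing.Theory Num.Theory.
Local Open Scope ring_scope.

(* A linear change of coordinates induces an automorphism of the exterior algebra, so we may
   assume that every entry is [\sum_l b_ij(l) w_l] with [w_l = 'i/2 dz_l /\ dzbar_l].  Griffiths
   positivity says that each 2x2 matrix [b(l)] is positive definite, and
   [det M = \sum_(k < l) D(k, l) w_k w_l] with [D(k, l) > 0] the mixed discriminant of [b(k)] and
   [b(l)].  Multiplication by [w_k w_l] only adds pairs {dz_k, dzbar_k}, so it splits into blocks
   indexed by the unpaired generators; when min(p, q) <= 1 a block sends subsets of size m to
   subsets of size m + 2 of a set of 2m + 2 indices, with m <= 1.  For m = 0 the block is the
   scalar D(k, l).  For m = 1 it is a 4x4 matrix equivalent to [D] with its diagonal
   erased.  [D] is Lorentzian with positive diagonal, so a kernel vector w of that matrix makes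
   [u = \sum_k w_k b(k)] satisfy D(b(j), u) = D(j, j) w_j, and the reverse Cauchy-Schwarz inequality
   gives [D(j, j) w_j^2 >= \sum_k D(k, k) w_k^2] for all four j, hence w = 0. *)

(** * The exterior algebra *)

Lemma disjoints_Ul (T : finType) (A B D : {set T}) :
  [disjoint A :|: B & D] = [disjoint A & D] && [disjoint B & D].
Proof. by rewrite -!setI_eq0 setIUl setU_eq0. Qed.

Lemma disjoints_Ur (T : finType) (A B D : {set T}) :
  [disjoint D & A :|: B] = [disjoint D & A] && [disjoint D & B].
Proof. by rewrite -!setI_eq0 setIUr setU_eq0. Qed.

Lemma prodr_setU (R : comPzRingType) (T : finType) (A B : {set T}) (F : T -> R) :
  [disjoint A & B] ->
  \prod_(x in A :|: B) F x = (\prod_(x in A) F x) * \prod_(x in B) F x.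
Proof. by move=> dAB; rewrite -bigU //; apply: eq_bigl => x; rewrite !inE. Qed.

Lemma set_indU1 (T : finType) (P : {set T} -> Prop) :
  P set0 -> (forall x (S : {set T}), x \notin S -> P S -> P (x |: S)) -> forall S, P S.
Proof.
move=> P0 PU S; elim: {S}#|S| {-2}S (erefl #|S|) => [|m IH] S cS.
  by rewrite (cards0_eq cS).
have /card_gt0P[x xS]: (0 < #|S|)%N by rewrite cS.
rewrite -(setD1K xS); apply: PU; first by rewrite !inE eqxx.
by apply: IH; move: cS; rewrite (cardsD1 x) xS => -[].
Qed.

Section ExteriorAlgebra.
Variables (C : numClosedFieldType) (n : nat).
Local Notation form := (form_t C n).
(* [\sum_i c i *: f i] elaborates to a sum in this semimodule structure; with the one inferred
   for plain finite functions the sum lemmas below would not rewrite. *)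
Local Notation formM :=
  (GRing.LSemiModule.sort ({ffun {set 'I_(n + n)} -> C^o} : lSemiModType C)).
Local Notation wedge := (@wedge C n).
Local Notation wsign := (@wsign C n).
Local Notation fbasis := (@fbasis C n).
Local Notation gen := (@gen C n).
Local Notation form1 := (@form1 C n).
Implicit Types (f g h : form) (A B S T : {set 'I_(n + n)}).

(** A product over pairs makes the sign multiplicative in each argument under disjoint union;
    associativity and all later sign computations rest on this. *)
Lemma wsignE A B :
  wsign A B = \prod_(x in A) \prod_(y in B) (if (y < x)%N then -1 else 1).
Proof.
rewrite /Defs.wsign -prodr_const pair_big_dep /=.
rewrite [RHS](bigID (fun p : 'I_(n + n) * 'I_(n + n) => (p.2 < p.1)%N)) /=.
rewrite [X in _ = _ * X]big1 ?mulr1; last by move=> p /andP[_ /negbTE->].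
apply: eq_big => p; first by rewrite inE andbA.
by rewrite inE => /and3P[_ _ ->].
Qed.

Lemma wsign0l B : wsign set0 B = 1.
Proof. by rewrite wsignE big_set0. Qed.

Lemma wsign0r A : wsign A set0 = 1.
Proof. by rewrite wsignE big1 // => x _; rewrite big_set0. Qed.

Lemma wsignUl A B T : [disjoint A & B] -> wsign (A :|: B) T = wsign A T * wsign B T.
Proof. by move=> dAB; rewrite !wsignE (prodr_setU _ dAB). Qed.

Lemma wsignUr A B T : [disjoint B & T] -> wsign A (B :|: T) = wsign A B * wsign A T.
Proof.
move=> dBT; rewrite !wsignE -big_split /=.
by apply: eq_bigr => x _; rewrite (prodr_setU _ dBT).
Qed.

Lemma wsign_sqr A B : wsign A B * wsign A B = 1.
Proof. by rewrite /Defs.wsign -expr2 sqrr_sign. Qed.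

Lemma wsign11 (x y : 'I_(n + n)) :
  wsign [set x] [set y] = if (y < x)%N then -1 else 1.
Proof. by rewrite wsignE !big_set1. Qed.

Lemma fbasisE A S : fbasis A S = (S == A)%:R.
Proof. by rewrite ffunE. Qed.

Lemma fscaleE (c : C) f S : (c *: f) S = c * f S.
Proof. by rewrite ffunE. Qed.

Lemma fbasis_sum f : f = \sum_S ((f S : C) *: fbasis S).
Proof.
apply/ffunP => T; rewrite sum_ffunE (bigD1 T) //= big1 => [|S neST].
  by rewrite fscaleE fbasisE eqxx mulr1 addr0.
by rewrite fscaleE fbasisE eq_sym (negbTE neST) mulr0.
Qed.

Lemma wedge_linearr f : linear (wedge f).
Proof.
move=> c g h; apply/ffunP => S; rewrite !ffunE scaler_sumr -big_split /=.
apply: eq_bigr => A _; rewrite scaler_sumr -big_split /=.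
apply: eq_bigr => B _; rewrite !ffunE.
by case: ifP => _; rewrite ?scaler0 ?addr0 // /GRing.scale /=; ring.
Qed.

Lemma wedge_linearl g : linear (wedge^~ g).
Proof.
move=> c f h; apply/ffunP => S; rewrite !ffunE scaler_sumr -big_split /=.
apply: eq_bigr => A _; rewrite scaler_sumr -big_split /=.
apply: eq_bigr => B _; rewrite !ffunE.
by case: ifP => _; rewrite ?scaler0 ?addr0 // /GRing.scale /=; ring.
Qed.

HB.instance Definition _ f :=
  GRing.isLinear.Build C form form *:%R (wedge f) (wedge_linearr f).

(** A named head symbol lets the linear structure in the left factor be declared and found by
    unification. *)
Definition wedger g f := wedge f g.

HB.instance Definition _ g :=
  GRing.isLinear.Build C form form *:%R (wedger g) (wedge_linearl g).

Lemma wedge0l g : wedge 0 g = 0. Proof. exact: (linear0 (wedger g)). Qed.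
Lemma wedgeDl f h g : wedge (f + h) g = wedge f g + wedge h g.
Proof. exact: (linearD (wedger g)). Qed.
Lemma wedgeBl f h g : wedge (f - h) g = wedge f g - wedge h g.
Proof. exact: (linearB (wedger g)). Qed.
Lemma wedgeZl c f g : wedge (c *: f) g = c *: wedge f g.
Proof. exact: (linearZ_LR (wedger g)). Qed.
Lemma wedgeZr c f g : wedge f (c *: g) = c *: wedge f g.
Proof. exact: (linearZ_LR (wedge f)). Qed.
Lemma wedge_suml I r (P : pred I) (F : I -> formM) g :
  wedge (\sum_(i <- r | P i) F i) g = \sum_(i <- r | P i) (wedge (F i) g : formM).
Proof. exact: (linear_sum (wedger g)). Qed.
Lemma wedge_sumr I r (P : pred I) (F : I -> formM) f :
  wedge f (\sum_(i <- r | P i) F i) = \sum_(i <- r | P i) (wedge f (F i) : formM).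
Proof. exact: (linear_sum (wedge f)). Qed.

Lemma wedge_fbasis A B :
  wedge (fbasis A) (fbasis B) =
  if [disjoint A & B] then wsign A B *: fbasis (A :|: B) else 0.
Proof.
apply/ffunP => S; rewrite ffunE (bigD1 A) //= [X in _ + X]big1 => [|A' neA]; last first.
  rewrite big1 // => B' _; rewrite !fbasisE (negbTE neA) mulr0 mul0r.
  by case: ifP.
rewrite (bigD1 B) //= [X in _ + X + _]big1 => [|B' neB]; last first.
  by rewrite !fbasisE (negbTE neB) mulr0; case: ifP.
rewrite !fbasisE !eqxx !mulr1 !addr0 andbC.
case: ifP => [/andP[-> /eqP ->]|]; first by rewrite fscaleE fbasisE eqxx mulr1.
case: ifP => dAB /=; last by rewrite ffunE.
by rewrite fscaleE fbasisE eq_sym => ->; rewrite mulr0.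
Qed.

(** By trilinearity it is enough to treat basis elements, where both bracketings give the sign
    [wsign A B * wsign A T * wsign B T]. *)
Lemma wedgeA f g h : wedge f (wedge g h) = wedge (wedge f g) h.
Proof.
rewrite (fbasis_sum h) !wedge_sumr; apply: eq_bigr => T _.
rewrite (fbasis_sum g) wedge_suml !wedge_sumr wedge_suml; apply: eq_bigr => B _.
rewrite (fbasis_sum f) !wedge_suml; apply: eq_bigr => A _.
rewrite !(wedgeZl, wedgeZr) !scalerA; congr (_ *: _); first by ring.
rewrite !wedge_fbasis.
case dAB: [disjoint A & B]; case dBT: [disjoint B & T];
  rewrite ?wedge0l ?linear0 // ?wedgeZr ?wedgeZl ?wedge_fbasis
    ?disjoints_Ul ?disjoints_Ur ?dAB ?dBT ?andbF ?andbT /= ?scaler0 //.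
case: ifP => _; last by rewrite !scaler0.
by rewrite !scalerA (wsignUl _ dAB) (wsignUr _ dBT) setUA; congr (_ *: _); ring.
Qed.

Lemma wedge1l f : wedge form1 f = f.
Proof.
rewrite {1}(fbasis_sum f) wedge_sumr [RHS]fbasis_sum; apply: eq_bigr => S _.
rewrite wedgeZr wedge_fbasis -setI_eq0 set0I eqxx set0U.
by rewrite wsign0l scale1r.
Qed.

Lemma wedge1r f : wedge f form1 = f.
Proof.
rewrite {1}(fbasis_sum f) wedge_suml [RHS]fbasis_sum; apply: eq_bigr => S _.
rewrite wedgeZl wedge_fbasis -setI_eq0 setI0 eqxx setU0.
by rewrite wsign0r scale1r.
Qed.

Lemma gen_fbasis x S :
  wedge (gen x) (fbasis S) =
  if x \in S then 0 else wsign [set x] S *: fbasis (x |: S).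
Proof. by rewrite wedge_fbasis disjoints1; case: (x \in S). Qed.

Lemma fbasisU1 x S : x \notin S ->
  fbasis (x |: S) = wsign [set x] S *: wedge (gen x) (fbasis S).
Proof.
by move=> xS; rewrite gen_fbasis (negbTE xS) scalerA wsign_sqr scale1r.
Qed.

(** The algebra is spanned by the elements obtained from [form1] by repeated left multiplication by
    generators; adding indices one at a time reaches every basis element up to sign. *)
Lemma form_ind (P : form -> Prop) :
  P 0 -> (forall (c : C) f g, P f -> P g -> P (c *: f + g)) -> P form1 ->
  (forall x f, P f -> P (wedge (gen x) f)) -> forall f, P f.
Proof.
move=> P0 PD P1 PW f; rewrite (fbasis_sum f).
elim/big_ind: _ => [|g h Pg Ph|S _] //; first by rewrite -[g]scale1r; apply: PD.
rewrite -[X in P X]addr0; apply: (PD) => //.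
move: S; apply: set_indU1 => // x S xS PS.
by rewrite fbasisU1 // -[X in P X]addr0; apply: (PD) => //; apply: PW.
Qed.

Lemma gen_anti x y : wedge (gen x) (gen y) = - wedge (gen y) (gen x).
Proof.
rewrite !gen_fbasis !inE eq_sym; case: eqP => [|/eqP neq]; first by rewrite oppr0.
rewrite !wsign11 setUC -scaleNr; congr (_ *: _).
by case: ltngtP neq => [||/ord_inj->]; rewrite ?opprK ?eqxx.
Qed.

Definition oneform (c : 'I_(n + n) -> C) : form := \sum_x (c x *: gen x).

Lemma oneform_anti c d :
  wedge (oneform c) (oneform d) = - wedge (oneform d) (oneform c).
Proof.
rewrite /oneform !wedge_suml.
under eq_bigr => x _ do rewrite wedge_sumr.
under [in RHS]eq_bigr => x _ do rewrite wedge_sumr.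
rewrite [in RHS]exchange_big -sumrN; apply: eq_bigr => x _.
rewrite -sumrN; apply: eq_bigr => y _.
by rewrite !(wedgeZl, wedgeZr) gen_anti !scalerN !scalerA mulrC.
Qed.

(** * Endomorphisms prescribed on the generators *)

Definition wedge_seq (psi : 'I_(n + n) -> form) (l : seq 'I_(n + n)) : form :=
  foldr (fun x acc => wedge (psi x) acc) form1 l.

(** The candidate for the universal property of the exterior algebra; it is multiplicative once the
    images [psi x] anticommute. *)
Definition ext (psi : 'I_(n + n) -> form) f : form :=
  \sum_S ((f S : C) *: wedge_seq psi (enum S)).

Lemma ext_linear psi : linear (ext psi).
Proof.
move=> c f g; rewrite /ext scaler_sumr -big_split /=; apply: eq_bigr => S _.
by rewrite !ffunE scalerDl scalerA.
Qed.

HB.instance Definition _ psi :=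
  GRing.isLinear.Build C form form *:%R (ext psi) (ext_linear psi).

Lemma ext_fbasis psi S : ext psi (fbasis S) = wedge_seq psi (enum S).
Proof.
rewrite /ext (bigD1 S) //= big1 => [|T neT].
  by rewrite fbasisE eqxx scale1r addr0.
by rewrite fbasisE (negbTE neT) scale0r.
Qed.

Section Anticommuting.
Variable psi : 'I_(n + n) -> form.
Hypothesis psi_anti : forall x y, wedge (psi x) (psi y) = - wedge (psi y) (psi x).

Lemma psi_sqr x : wedge (psi x) (psi x) = 0.
Proof.
have /eqP := psi_anti x x; rewrite -addr_eq0 -mulr2n -scaler_nat scaler_eq0.
by rewrite pnatr_eq0 => /eqP.
Qed.

(** Moving [psi x] to its sorted place costs -1 for each smaller factor passed, and meeting a second
    [psi x] gives 0. Filtering one sorted list [r] describes [S] and [x |: S] together, which allows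
    induction on [r]. *)
Lemma wedge_seq_insert (r : seq 'I_(n + n)) S x :
  sorted (fun a b : 'I_(n + n) => (a < b)%N) r -> x \in r ->
  wedge (psi x) (wedge_seq psi [seq y <- r | y \in S]) =
  if x \in S then 0 else
  (\prod_(y <- r | y \in S) (if (y < x)%N then -1 else 1)) *:
     wedge_seq psi [seq y <- r | y \in x |: S].
Proof.
elim: r => // y r IH srt; rewrite inE.
have tr : transitive (fun a b : 'I_(n + n) => (a < b)%N).
  by move=> a b c; apply: ltn_trans.
have lt_y z : z \in r -> (y < z)%N.
  by move: srt; rewrite /= (path_sortedE tr) => /andP[/allP h _]; apply: h.
have {}srt : sorted (fun a b : 'I_(n + n) => (a < b)%N) r by apply: path_sorted srt.
have [-> _ | nexy /= xr] := eqVneq x y.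
  rewrite /= !inE eqxx /=; case: ifP => yS /=.
    by rewrite wedgeA psi_sqr wedge0l.
  (* Here [x] heads the sorted list, so no remaining element is smaller and every sign is 1. *)
  rewrite big_cons yS big1_seq ?scale1r => [|z /andP[_ zr]].
    congr (wedge _ (wedge_seq _ _)); apply: eq_in_filter => z zr.
    by rewrite !inE; case: eqP => // ezy; move: (lt_y _ zr); rewrite ezy ltnn.
  by rewrite ltnNge ltnW ?lt_y.
rewrite big_cons !inE eq_sym (negbTE nexy) /=.
case: ifP => yS /=; last exact: IH.
rewrite wedgeA psi_anti -scaleN1r wedgeZl -wedgeA IH // lt_y //.
by case: ifP => _; rewrite ?linear0 ?scaler0 // wedgeZr scalerA.
Qed.

Lemma ext_gen_fbasis x S :
  ext psi (wedge (gen x) (fbasis S)) = wedge (psi x) (ext psi (fbasis S)).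
Proof.
have enumE T : enum (T : {set 'I_(n + n)}) = [seq y <- enum 'I_(n + n) | y \in T].
  by rewrite {1}/enum_mem enumT; apply: eq_filter.
rewrite gen_fbasis ext_fbasis enumE wedge_seq_insert ?mem_enum //; last first.
  rewrite -[sorted _ _]/(sorted (relpre val ltn) _) -sorted_map.
  by rewrite val_enum_ord iota_ltn_sorted.
case: ifP => xS; first by rewrite linear0.
rewrite linearZ_LR /= ext_fbasis enumE; congr (_ *: _).
by rewrite wsignE big_set1 big_enum_cond /=; apply: eq_bigl => y.
Qed.

Lemma ext_genl x f : ext psi (wedge (gen x) f) = wedge (psi x) (ext psi f).
Proof.
rewrite {1}(fbasis_sum f) wedge_sumr linear_sum [in RHS]/ext wedge_sumr; apply: eq_bigr => S _.
by rewrite !wedgeZr linearZ_LR /= ext_gen_fbasis ext_fbasis.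
Qed.

Lemma ext1 : ext psi form1 = form1.
Proof. by rewrite ext_fbasis enum_set0. Qed.

Lemma ext_gen x : ext psi (gen x) = psi x.
Proof. by rewrite -[gen x]wedge1r ext_genl ext1 wedge1r. Qed.

Lemma ext_wedge f g : ext psi (wedge f g) = wedge (ext psi f) (ext psi g).
Proof.
elim/form_ind: f => [|c f h IHf IHh||x f IH].
- by rewrite wedge0l !linear0 wedge0l.
- by rewrite wedgeDl wedgeZl !linearP /= IHf IHh wedgeDl wedgeZl.
- by rewrite ext1 !wedge1l.
- by rewrite -wedgeA !ext_genl IH wedgeA.
Qed.

End Anticommuting.

(** * Bidegrees *)

Lemma is_pq0 p q : is_pq p q (0 : form).
Proof. by move=> S; rewrite ffunE eqxx. Qed.

Lemma is_pqP p q (c : C) f g : is_pq p q f -> is_pq p q g -> is_pq p q (c *: f + g).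
Proof.
move=> Hf Hg S; rewrite !ffunE; have [f0|/Hf //] := eqVneq (f S) 0.
by rewrite f0 scaler0 add0r => /Hg.
Qed.

Lemma is_pqZ p q (c : C) f : is_pq p q f -> is_pq p q (c *: f).
Proof. by move=> Hf; rewrite -[_ *: _]addr0; apply: is_pqP => //; apply: is_pq0. Qed.

Lemma is_pq_sum p q I r (P : pred I) (F : I -> formM) :
  (forall i, P i -> is_pq p q (F i : form)) ->
  is_pq p q (\sum_(i <- r | P i) F i : form).
Proof.
move=> H; apply: big_ind => //; first exact: is_pq0.
by move=> f g Hf Hg; rewrite -[f]scale1r; apply: is_pqP.
Qed.

Lemma hol_partU A B : hol_part (A :|: B) = hol_part A :|: hol_part B.
Proof. by apply/setP => k; rewrite !inE. Qed.

Lemma ahol_partU A B : ahol_part (A :|: B) = ahol_part A :|: ahol_part B.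
Proof. by apply/setP => k; rewrite !inE. Qed.

Lemma is_pq_wedge p q p' q' f g :
  is_pq p q f -> is_pq p' q' g -> is_pq (p + p') (q + q') (wedge f g).
Proof.
move=> Hf Hg S; rewrite (fbasis_sum f) (fbasis_sum g) => nz.
have Hs: is_pq (p + p') (q + q') (wedge f g); last first.
  by apply: Hs; rewrite (fbasis_sum f) (fbasis_sum g).
rewrite (fbasis_sum f) wedge_suml; apply: is_pq_sum => A _.
rewrite wedgeZl; have [->|/Hf[cA cA']] := eqVneq (f A) 0.
  by rewrite scale0r; apply: is_pq0.
apply: is_pqZ; rewrite (fbasis_sum g) wedge_sumr; apply: is_pq_sum => B _.
rewrite wedgeZr; have [->|/Hg[cB cB']] := eqVneq (g B) 0.
  by rewrite scale0r; apply: is_pq0.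
apply: is_pqZ; rewrite wedge_fbasis; case: ifP => dAB; last exact: is_pq0.
apply: is_pqZ => T; rewrite fbasisE; have [-> _|] := eqVneq T; last by rewrite eqxx.
rewrite hol_partU ahol_partU !cardsU cA cA' cB cB'.
have -> : hol_part A :&: hol_part B = set0.
  by apply/setP => k; rewrite !inE; case: (boolP (_ \in A)) => // /(disjointFr dAB).
have -> : ahol_part A :&: ahol_part B = set0.
  by apply/setP => k; rewrite !inE; case: (boolP (_ \in A)) => // /(disjointFr dAB).
by rewrite cards0 !subn0.
Qed.

End ExteriorAlgebra.

(** * Linear changes of coordinates *)

Section LinearCoordinates.
Variables (C : numClosedFieldType) (n : nat).
Local Notation form := (form_t C n).
Local Notation formM :=
  (GRing.LSemiModule.sort ({ffun {set 'I_(n + n)} -> C^o} : lSemiModType C)).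
Local Notation wedge := (@wedge C n).
Local Notation fbasis := (@fbasis C n).
Local Notation gen := (@gen C n).
Local Notation form1 := (@form1 C n).
Local Notation dzi := (@dzi n).
Local Notation dzbi := (@dzbi n).
Implicit Types (f g : form) (S : {set 'I_(n + n)}) (P Q : 'M[C]_(n + n)) (A B : 'M[C]_n).

Definition mxform P (x : 'I_(n + n)) : form := oneform (P x).

Lemma mxform_anti P x y :
  wedge (mxform P x) (mxform P y) = - wedge (mxform P y) (mxform P x).
Proof. exact: oneform_anti. Qed.

Lemma ext_mxform P Q x : ext (mxform P) (mxform Q x) = mxform (Q *m P) x.
Proof.
rewrite /mxform /oneform linear_sum /=.
under eq_bigr => y _ do rewrite linearZ_LR /= (ext_gen (mxform_anti P)) scaler_sumr.
rewrite exchange_big; apply: eq_bigr => z _.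
by rewrite mxE scaler_suml; apply: eq_bigr => y _; rewrite scalerA.
Qed.

Lemma mxform1 x : mxform 1%:M x = gen x.
Proof.
rewrite /mxform /oneform (bigD1 x) //= big1 => [|y neyx].
  by rewrite mxE eqxx scale1r addr0.
by rewrite mxE eq_sym (negbTE neyx) scale0r.
Qed.

Lemma ext_mxformK P Q : Q *m P = 1%:M ->
  cancel (ext (mxform Q)) (ext (mxform P)).
Proof.
move=> QP f; elim/form_ind: f => [|c f h IHf IHh||x f IH].
- by rewrite !linear0.
- by rewrite !linearP /= IHf IHh.
- by rewrite !ext1.
- rewrite (ext_genl (mxform_anti Q)) (ext_wedge (mxform_anti P)) IH.
  by rewrite ext_mxform QP mxform1.
Qed.

(** A holomorphic change of coordinates acts on the antiholomorphic generators by the conjugate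
    matrix; the zero blocks make it preserve bidegree. *)
Definition coord_mx A : 'M[C]_(n + n) := block_mx A 0 0 (map_mx Num.conj A).

Lemma coord_mxM A B : coord_mx A *m coord_mx B = coord_mx (A *m B).
Proof.
by rewrite /coord_mx mulmx_block !mulmx0 !mul0mx !addr0 add0r map_mxM.
Qed.

Lemma coord_mx1 : coord_mx 1%:M = 1%:M.
Proof. by rewrite /coord_mx map_mx1 -scalar_mx_block. Qed.

Lemma mxform_dzi A k : mxform (coord_mx A) (dzi k) = dw A k.
Proof.
rewrite /mxform /oneform big_split_ord /= [X in _ + X]big1 => [|j _].
  by rewrite addr0; apply: eq_bigr => j _; rewrite block_mxEul.
by rewrite block_mxEur mxE scale0r.
Qed.

Lemma mxform_dzbi A k : mxform (coord_mx A) (dzbi k) = \sum_j ((A k j)^* *: dzb C j).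
Proof.
rewrite /mxform /oneform big_split_ord /= [X in X + _]big1 => [|j _].
  by rewrite add0r; apply: eq_bigr => j _; rewrite block_mxEdr mxE.
by rewrite block_mxEdl mxE scale0r.
Qed.

Lemma fconj_sum I r (c : I -> C) (F : I -> formM) :
  fconj (\sum_(i <- r) (c i *: F i)) = \sum_(i <- r) ((c i)^* *: (fconj (F i) : formM)).
Proof.
rewrite /fconj; under [RHS]eq_bigr => i _ do rewrite scaler_sumr.
rewrite exchange_big /=; apply: eq_bigr => S _.
rewrite sum_ffunE rmorph_sum scaler_suml; apply: eq_bigr => i _.
by rewrite fscaleE rmorphM scalerA.
Qed.

Lemma swapgen_dzi k : swapgen (dzi k) = dzbi k.
Proof. by rewrite /swapgen (unsplitK (inl k)). Qed.

Lemma fconj_dz (k : 'I_n) : fconj (dz C k) = dzb C k.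
Proof.
rewrite /fconj (bigD1 [set dzi k]) //= big1 => [|S neS].
  rewrite fbasisE eqxx conjC1 scale1r addr0 enum_set1 /= swapgen_dzi.
  exact: wedge1r.
by rewrite fbasisE (negbTE neS) conjC0 scale0r.
Qed.

(** This removes [fconj] from Kähler terms, which become images of generators and so transform by
    functoriality of [ext]. *)
Lemma fconj_dw A k : fconj (dw A k) = mxform (coord_mx A) (dzbi k).
Proof.
by rewrite mxform_dzbi /dw fconj_sum; apply: eq_bigr => j _; rewrite fconj_dz.
Qed.

Lemma kahler_termE A l : kahler_term A l =
  ('i / 2%:R) *: wedge (mxform (coord_mx A) (dzi l)) (mxform (coord_mx A) (dzbi l)).
Proof. by rewrite /kahler_term fconj_dw mxform_dzi. Qed.

Lemma ext_kahler_term A B l :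
  ext (mxform (coord_mx B)) (kahler_term A l) = kahler_term (A *m B) l.
Proof.
rewrite !kahler_termE linearZ_LR /= (ext_wedge (mxform_anti _)).
by rewrite !ext_mxform coord_mxM.
Qed.

Definition pair_set (k : 'I_n) : {set 'I_(n + n)} := [set dzi k; dzbi k].

Lemma dzi_eq j k : (dzi j == dzi k) = (j == k).
Proof. exact: (inj_eq (@lshift_inj _ _)). Qed.

Lemma dzbi_eq j k : (dzbi j == dzbi k) = (j == k).
Proof. exact: (inj_eq (@rshift_inj _ _)). Qed.

Lemma dzi_dzbi j k : (dzi j == dzbi k) = false.
Proof. exact: eq_lrshift. Qed.

Lemma dzbi_dzi j k : (dzbi j == dzi k) = false.
Proof. exact: eq_rlshift. Qed.

Lemma wedge_dz_dzb (j k : 'I_n) : wedge (dz C j) (dzb C k) = fbasis [set dzi j; dzbi k].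
Proof.
rewrite /dz /dzb gen_fbasis !inE dzi_dzbi wsign11 /=.
by rewrite ltnNge ltnW ?scale1r // (leq_trans (ltn_ord j)) ?leq_addr.
Qed.

Lemma pair_set_eq m j k : (pair_set m == [set dzi j; dzbi k]) = (m == j) && (m == k).
Proof.
apply/eqP/andP => [/setP eS|[/eqP<- /eqP<-] //].
have := eS (dzi m); have := eS (dzbi m).
rewrite !inE !(dzi_eq, dzbi_eq, dzi_dzbi, dzbi_dzi) !eqxx /= !orbF.
by move=> <- <-.
Qed.

Lemma kahler_term_pair A l m :
  kahler_term A l (pair_set m) = ('i / 2%:R) * `|A l m| ^+ 2.
Proof.
rewrite kahler_termE mxform_dzi mxform_dzbi fscaleE; congr (_ * _).
rewrite /dw; set h := (X in wedge _ X).
rewrite wedge_suml sum_ffunE (bigD1 m) //= big1 => [|j nejm]; last first.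
  rewrite wedgeZl /h wedge_sumr fscaleE sum_ffunE big1 ?mulr0 // => k _.
  rewrite wedgeZr fscaleE wedge_dz_dzb fbasisE pair_set_eq eq_sym.
  by rewrite (negbTE nejm) mulr0.
rewrite wedgeZl /h wedge_sumr fscaleE sum_ffunE (bigD1 m) //= big1 => [|k nekm].
  by rewrite wedgeZr fscaleE wedge_dz_dzb fbasisE eqxx mulr1 !addr0 -normCK.
rewrite wedgeZr fscaleE wedge_dz_dzb fbasisE pair_set_eq eqxx eq_sym.
by rewrite (negbTE nekm) mulr0.
Qed.

Lemma kahler_term1 l : kahler_term 1%:M l = ('i / 2%:R) *: fbasis (pair_set l).
Proof. by rewrite kahler_termE coord_mx1 !mxform1 wedge_dz_dzb. Qed.

(** Pulling back by the inverse of [A] makes the left side diagonal. Comparing coefficients on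
    [pair_set m] gives [beta m] as the sum of [|E l m|^2] with [E = A' *m invmx A], and a column of
    an invertible matrix is nonzero. *)
Lemma kahler_coef_gt0 A (beta : 'I_n -> C) : A \in unitmx ->
  is_kahler (\sum_l (beta l *: kahler_term A l)) -> forall m, 0 < beta m.
Proof.
move=> uA [A' [uA' eqA]] m.
have := congr1 (ext (mxform (coord_mx (invmx A)))) eqA.
rewrite !linear_sum /=.
under eq_bigr => l _ do
  rewrite linearZ_LR /= ext_kahler_term mulmxV // kahler_term1.
under [in RHS]eq_bigr => l _ do rewrite ext_kahler_term.
set E := A' *m invmx A => /ffunP/(_ (pair_set m)).
rewrite !sum_ffunE (bigD1 m) //= big1 => [|l nelm]; last first.
  rewrite !fscaleE fbasisE [pair_set l]/pair_set pair_set_eq eq_sym.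
  by rewrite (negbTE nelm) !mulr0.
under eq_bigr => l _ do rewrite kahler_term_pair.
rewrite !fscaleE fbasisE eqxx mulr1 addr0 mulrC -mulr_sumr.
have i2 : ('i / 2%:R : C) != 0.
  by rewrite mulf_neq0 ?invr_eq0 ?pnatr_eq0 // neq0Ci.
move/(mulfI i2) => ->.
have uE : E \in unitmx by rewrite unitmx_mul uA' unitmx_inv.
rewrite lt0r sumr_ge0 ?andbT => [|l _]; last by rewrite exprn_ge0.
apply: contraTN uE => /eqP s0.
have E0 l : E l m = 0.
  have := psumr_eq0P (fun l _ => exprn_ge0 2 (normr_ge0 (E l m))) s0 (i := l) isT.
  by move/eqP; rewrite expf_eq0 normr_eq0 => /eqP.
apply/negP => uE; have := mulVmx uE => /matrixP/(_ m m).
rewrite !mxE eqxx big1 => [/eqP|l _]; first by rewrite eq_sym oner_eq0.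
by rewrite E0 mulr0.
Qed.

Lemma is_pq_dzi A k : is_pq 1 0 (mxform (coord_mx A) (dzi k)).
Proof.
rewrite mxform_dzi; apply: is_pq_sum => j _; apply: is_pqZ => S.
rewrite fbasisE; have [-> _|] := eqVneq S; last by rewrite eqxx.
split; last first.
  by apply/eqP; rewrite cards_eq0; apply/eqP/setP => i; rewrite !inE dzbi_dzi.
rewrite -[RHS](cards1 j); congr #|pred_of_set _|.
by apply/setP => i; rewrite !inE dzi_eq.
Qed.

Lemma is_pq_dzbi A k : is_pq 0 1 (mxform (coord_mx A) (dzbi k)).
Proof.
rewrite mxform_dzbi; apply: is_pq_sum => j _; apply: is_pqZ => S.
rewrite fbasisE; have [-> _|] := eqVneq S; last by rewrite eqxx.
split; first by apply/eqP; rewrite cards_eq0; apply/eqP/setP => i; rewrite !inE dzi_dzbi.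
rewrite -[RHS](cards1 j); congr #|pred_of_set _|.
by apply/setP => i; rewrite !inE dzbi_eq.
Qed.

(** Each generator is sent to a one-form of its own type, so bidegrees add up as before along the
    product. *)
Lemma is_pq_ext A p q f : is_pq p q f -> is_pq p q (ext (mxform (coord_mx A)) f).
Proof.
move=> Hf; rewrite (fbasis_sum f) linear_sum; apply: is_pq_sum => S _.
rewrite linearZ_LR /=; have [->|/Hf[<- <-]] := eqVneq (f S) 0.
  by rewrite scale0r; apply: is_pq0.
apply: is_pqZ; move: S; apply: set_indU1 => [|x S xS IH].
  rewrite ext1 => T; rewrite fbasisE; have [-> _ //|] := eqVneq T.
  by rewrite eqxx.
rewrite fbasisU1 // linearZ_LR /= ext_gen_fbasis; last exact: mxform_anti.
apply: is_pqZ; rewrite hol_partU ahol_partU.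
case: (split_ordP x) => k xk; move: xS; rewrite {x}xk => xS.
  have -> : hol_part [set lshift n k] = [set k].
    by apply/setP => i; rewrite !inE dzi_eq.
  have -> : ahol_part [set lshift n k] = set0.
    by apply/setP => i; rewrite !inE dzbi_dzi.
  by have := is_pq_wedge (@is_pq_dzi A k) IH; rewrite cardsU1 set0U inE xS.
have -> : hol_part [set rshift n k] = set0.
  by apply/setP => i; rewrite !inE dzi_dzbi.
have -> : ahol_part [set rshift n k] = [set k].
  by apply/setP => i; rewrite !inE dzbi_eq.
by have := is_pq_wedge (@is_pq_dzbi A k) IH; rewrite cardsU1 set0U inE xS.
Qed.

End LinearCoordinates.

(** * Mixed discriminants *)

Section MixedDiscriminant.
Variables (C : numClosedFieldType) (I : Type) (p q z : I -> C).
Hypothesis p_gt0 : forall i, 0 < p i.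
Hypothesis q_real : forall i, q i \is Num.real.
Hypothesis det_gt0 : forall i, 0 < p i * q i - z i * (z i)^*.

(** The polarization det(B_i + B_j) - det B_i - det B_j of the determinant on hermitian 2x2
    matrices; in particular [D i i] is twice det B_i. *)
Definition mixdisc i j := p i * q j + p j * q i - z i * (z j)^* - z j * (z i)^*.
Local Notation D := mixdisc.

Lemma mixdiscC i j : D i j = D j i.
Proof. rewrite /D; ring. Qed.

Let p_conj i : (p i)^* = p i. Proof. exact/CrealP/gtr0_real. Qed.
Let q_conj i : (q i)^* = q i. Proof. exact/CrealP. Qed.

(** Multiplied by [p i * p j], it is a squared modulus plus positive multiples of the two
    determinants. *)
Lemma mixdisc_gt0 i j : 0 < D i j.
Proof.
rewrite -(pmulr_rgt0 _ (mulr_gt0 (p_gt0 i) (p_gt0 j))).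
have -> : p i * p j * D i j =
    (p i * z j - p j * z i) * (p i * z j - p j * z i)^*
    + (p i ^+ 2 * (p j * q j - z j * (z j)^*)
      + p j ^+ 2 * (p i * q i - z i * (z i)^*)).
  rewrite rmorphB !rmorphM /= !p_conj /D; ring.
apply: ltr_wpDl; first exact: mul_conjC_ge0.
by apply: addr_gt0; apply: mulr_gt0; rewrite ?exprn_gt0.
Qed.

(* [B_i] stands for the positive definite matrix with rows (p i, z i), ((z i)^*, q i) and
   [u] for the hermitian matrix with rows (a, y), (y^*, b). The right-hand side is the reverse
   Cauchy-Schwarz gap for the Lorentzian form [2 * det]: multiplied by [p i ^+ 2] it is a
   sum of squares, because det (u - t B_i) <= 0 at t = a / p i. *)
Lemma mixdisc_reverse_CS i (a b y : C) : a \is Num.real -> b \is Num.real ->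
  0 <= (p i * b + q i * a - z i * y^* - (z i)^* * y) ^+ 2
       - D i i * (2%:R * (a * b - y * y^*)).
Proof.
move=> ra rb; set G := p i * b + _ - _ - _.
have aE : a^* = a by apply/CrealP.
have bE : b^* = b by apply/CrealP.
have rG : G \is Num.real.
  by apply/CrealP; rewrite /G !rmorphB rmorphD !rmorphM /= !conjCK p_conj q_conj aE bE; ring.
rewrite -(pmulr_rge0 _ (exprn_gt0 2 (p_gt0 i))).
have -> : p i ^+ 2 * (G ^+ 2 - D i i * (2%:R * (a * b - y * y^*))) =
    (D i i * a - p i * G) ^+ 2
    + 2%:R * D i i * ((p i * y - a * z i) * (p i * y - a * z i)^*).
  rewrite rmorphB !rmorphM /= p_conj aE /G /D; ring.
apply: addr_ge0; last first.
  by rewrite mulr_ge0 ?mul_conjC_ge0 // mulr_ge0 ?ler0n // ltW // mixdisc_gt0.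
rewrite real_exprn_even_ge0 // rpredB // rpredM //; apply: gtr0_real => //.
exact: mixdisc_gt0.
Qed.

Lemma mixdisc_offdiag_kernel_real i0 i1 i2 i3 (w0 w1 w2 w3 : C) :
  w0 \is Num.real -> w1 \is Num.real -> w2 \is Num.real -> w3 \is Num.real ->
  D i0 i1 * w1 + D i0 i2 * w2 + D i0 i3 * w3 = 0 ->
  D i1 i0 * w0 + D i1 i2 * w2 + D i1 i3 * w3 = 0 ->
  D i2 i0 * w0 + D i2 i1 * w1 + D i2 i3 * w3 = 0 ->
  D i3 i0 * w0 + D i3 i1 * w1 + D i3 i2 * w2 = 0 -> w0 = 0.
Proof.
move=> r0 r1 r2 r3 E0 E1 E2 E3.
(* [a], [b], [y] are the entries of the hermitian matrix u, the combination of the four B_i with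
   weights w. *)
pose a := p i0 * w0 + p i1 * w1 + p i2 * w2 + p i3 * w3.
pose b := q i0 * w0 + q i1 * w1 + q i2 * w2 + q i3 * w3.
pose y := z i0 * w0 + z i1 * w1 + z i2 * w2 + z i3 * w3.
have yE : y^* = (z i0)^* * w0 + (z i1)^* * w1 + (z i2)^* * w2 + (z i3)^* * w3.
  by rewrite /y !rmorphD !rmorphM /= (CrealP r0) (CrealP r1) (CrealP r2) (CrealP r3).
have p_real i : p i \is Num.real by apply: gtr0_real.
have ra : a \is Num.real by rewrite /a !rpredD // rpredM.
have rb : b \is Num.real by rewrite /b !rpredD // rpredM.
(* The left side is the mixed discriminant of B_i and u; the kernel equations then leave only its
   diagonal term. *)
have GE i : p i * b + q i * a - z i * y^* - (z i)^* * y =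
    D i i0 * w0 + D i i1 * w1 + D i i2 * w2 + D i i3 * w3.
  by rewrite yE /a /b /y /D; ring.
have R0 : p i0 * b + q i0 * a - z i0 * y^* - (z i0)^* * y = D i0 i0 * w0.
  by rewrite GE -[RHS]addr0 -E0; ring.
have R1 : p i1 * b + q i1 * a - z i1 * y^* - (z i1)^* * y = D i1 i1 * w1.
  by rewrite GE -[RHS]addr0 -E1; ring.
have R2 : p i2 * b + q i2 * a - z i2 * y^* - (z i2)^* * y = D i2 i2 * w2.
  by rewrite GE -[RHS]addr0 -E2; ring.
have R3 : p i3 * b + q i3 * a - z i3 * y^* - (z i3)^* * y = D i3 i3 * w3.
  by rewrite GE -[RHS]addr0 -E3; ring.
pose t i w := D i i * w ^+ 2.
(* Twice det u is the mixed discriminant of u with itself, expanded linearly in one of its two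
   arguments. *)
have SE : 2%:R * (a * b - y * y^*) = t i0 w0 + t i1 w1 + t i2 w2 + t i3 w3.
  transitivity (w0 * (p i0 * b + q i0 * a - z i0 * y^* - (z i0)^* * y)
    + w1 * (p i1 * b + q i1 * a - z i1 * y^* - (z i1)^* * y)
    + w2 * (p i2 * b + q i2 * a - z i2 * y^* - (z i2)^* * y)
    + w3 * (p i3 * b + q i3 * a - z i3 * y^* - (z i3)^* * y)).
    by rewrite yE /a /b /y; ring.
  rewrite R0 R1 R2 R3 /t; ring.
have t_ge0 i w : w \is Num.real -> 0 <= t i w.
  move=> rw; rewrite mulr_ge0 ?real_exprn_even_ge0 //.
  exact/ltW/mixdisc_gt0.
have CS i w : p i * b + q i * a - z i * y^* - (z i)^* * y = D i i * w ->
    t i0 w0 + t i1 w1 + t i2 w2 + t i3 w3 <= t i w.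
  move=> Gw; have := mixdisc_reverse_CS i y ra rb; rewrite Gw SE.
  have -> : (D i i * w) ^+ 2 = D i i * t i w by rewrite /t; ring.
  by rewrite -mulrBr (pmulr_rge0 _ (mixdisc_gt0 i i)) subr_ge0.
have C0 : t i0 w0 + t i1 w1 + t i2 w2 + t i3 w3 <= t i0 w0.
  exact: CS R0.
have C1 : t i0 w0 + t i1 w1 + t i2 w2 + t i3 w3 <= t i1 w1.
  exact: CS R1.
have T0 := t_ge0 i0 _ r0; have T1 := t_ge0 i1 _ r1.
have T2 := t_ge0 i2 _ r2; have T3 := t_ge0 i3 _ r3.
(* The bound at [i0] makes the sum of the other three nonnegative terms at most 0, hence
   [t i1 w1 <= 0]; the bound at [i1] then does the same for the whole sum. *)
have t1 : t i1 w1 <= 0.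
  rewrite -(lerD2l (t i0 w0)) addr0; apply: le_trans C0.
  by rewrite -[X in _ <= X]addrA lerDl addr_ge0.
have t0 : t i0 w0 = 0.
  apply/le_anti; rewrite T0 andbT; apply: le_trans t1; apply: le_trans C1.
  by rewrite -!addrA lerDl !addr_ge0.
by move/eqP: t0; rewrite mulf_eq0 gt_eqF ?mixdisc_gt0 //= expf_eq0 => /eqP.
Qed.

(** The coefficients [D] are real, so the real and imaginary parts of a solution are again
    solutions. *)
Lemma mixdisc_offdiag_kernel i0 i1 i2 i3 (w0 w1 w2 w3 : C) :
  D i0 i1 * w1 + D i0 i2 * w2 + D i0 i3 * w3 = 0 ->
  D i1 i0 * w0 + D i1 i2 * w2 + D i1 i3 * w3 = 0 ->
  D i2 i0 * w0 + D i2 i1 * w1 + D i2 i3 * w3 = 0 ->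
  D i3 i0 * w0 + D i3 i1 * w1 + D i3 i2 * w2 = 0 -> w0 = 0.
Proof.
move=> E0 E1 E2 E3.
have rD i j : D i j \is Num.real by apply/gtr0_real/mixdisc_gt0.
have ReE x1 x2 x3 i1' i2' i3' j : D j i1' * x1 + D j i2' * x2 + D j i3' * x3 = 0 ->
    D j i1' * 'Re x1 + D j i2' * 'Re x2 + D j i3' * 'Re x3 = 0.
  by rewrite -!ReMl // -!raddfD => ->; rewrite raddf0.
have ImE x1 x2 x3 i1' i2' i3' j : D j i1' * x1 + D j i2' * x2 + D j i3' * x3 = 0 ->
    D j i1' * 'Im x1 + D j i2' * 'Im x2 + D j i3' * 'Im x3 = 0.
  by rewrite -!ImMl // -!raddfD => ->; rewrite raddf0.
rewrite [w0]Crect.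
rewrite (mixdisc_offdiag_kernel_real _ _ _ _
  (ReE _ _ _ _ _ _ _ E0) (ReE _ _ _ _ _ _ _ E1) (ReE _ _ _ _ _ _ _ E2)
  (ReE _ _ _ _ _ _ _ E3)) ?Creal_Re //.
rewrite (mixdisc_offdiag_kernel_real _ _ _ _
  (ImE _ _ _ _ _ _ _ E0) (ImE _ _ _ _ _ _ _ E1) (ImE _ _ _ _ _ _ _ E2)
  (ImE _ _ _ _ _ _ _ E3)) ?Creal_Im //.
by rewrite mulr0 addr0.
Qed.

(* The matrix here, with entry the mixed discriminant of the two indices complementary to
   (m, j), is the off-diagonal matrix of [D] up to rescaling rows and columns: the unknown
   at j gets multiplied by the product of [D] over the triangle avoiding j. *)
Lemma mixdisc_compl_kernel i0 i1 i2 i3 (v0 v1 v2 v3 : C) :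
  D i2 i3 * v1 + D i1 i3 * v2 + D i1 i2 * v3 = 0 ->
  D i2 i3 * v0 + D i0 i3 * v2 + D i0 i2 * v3 = 0 ->
  D i1 i3 * v0 + D i0 i3 * v1 + D i0 i1 * v3 = 0 ->
  D i1 i2 * v0 + D i0 i2 * v1 + D i0 i1 * v2 = 0 -> v0 = 0.
Proof.
move=> E0 E1 E2 E3.
have scaled (c x : C) : x = 0 -> c * x = 0 by move=> ->; rewrite mulr0.
have : v0 * (D i1 i2 * D i1 i3 * D i2 i3) = 0.
  apply: (@mixdisc_offdiag_kernel i0 i1 i2 i3 _ (v1 * (D i0 i2 * D i0 i3 * D i2 i3))
    (v2 * (D i0 i1 * D i0 i3 * D i1 i3)) (v3 * (D i0 i1 * D i0 i2 * D i1 i2))).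
  (* Equation m is multiplied by the product of [D] over the three pairs containing m. *)
  - by rewrite -[RHS](scaled (D i0 i1 * D i0 i2 * D i0 i3) _ E0); ring.
  - by rewrite (mixdiscC i1 i0) -[RHS](scaled (D i0 i1 * D i1 i2 * D i1 i3) _ E1); ring.
  - rewrite (mixdiscC i2 i0) (mixdiscC i2 i1).
    by rewrite -[RHS](scaled (D i0 i2 * D i1 i2 * D i2 i3) _ E2); ring.
  - rewrite (mixdiscC i3 i0) (mixdiscC i3 i1) (mixdiscC i3 i2).
    by rewrite -[RHS](scaled (D i0 i3 * D i1 i3 * D i2 i3) _ E3); ring.
by move/eqP; rewrite !mulf_eq0 !(gt_eqF (mixdisc_gt0 _ _)) !orbF => /eqP.
Qed.

End MixedDiscriminant.

(** * Block decomposition *)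

Section PairBlocks.
Variables (C : numClosedFieldType) (n : nat).
Local Notation form := (form_t C n).
Local Notation formM :=
  (GRing.LSemiModule.sort ({ffun {set 'I_(n + n)} -> C^o} : lSemiModType C)).
Local Notation wedge := (@wedge C n).
Local Notation wsign := (@wsign C n).
Local Notation fbasis := (@fbasis C n).
Local Notation dzi := (@dzi n).
Local Notation dzbi := (@dzbi n).
Implicit Types (a f g : form) (S T X : {set 'I_(n + n)}) (G H : {set 'I_n}).

Definition ord_eqE := (@dzi_eq n, @dzbi_eq n, @dzi_dzbi n, @dzbi_dzi n).

Lemma setP_dz S T : (forall k, (dzi k \in S) = (dzi k \in T)) ->
  (forall k, (dzbi k \in S) = (dzbi k \in T)) -> S = T.
Proof. by move=> h1 h2; apply/setP => x; case: (split_ordP x) => k ->; [exact: h1|exact: h2]. Qed.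

Lemma subset_dz S T : (forall k, dzi k \in S -> dzi k \in T) ->
  (forall k, dzbi k \in S -> dzbi k \in T) -> S \subset T.
Proof.
by move=> h1 h2; apply/subsetP => x; case: (split_ordP x) => k ->; [exact: h1|exact: h2].
Qed.

Lemma wedge_fbasisr a T S : wedge a (fbasis T) S =
  if T \subset S then wsign (S :\: T) T * a (S :\: T) else 0.
Proof.
rewrite {1}(fbasis_sum a) wedge_suml sum_ffunE.
under eq_bigr => A _ do rewrite wedgeZl fscaleE wedge_fbasis.
case: ifP => TS.
  have dST : [disjoint S :\: T & T] by rewrite -setI_eq0 setIDAC setDIl setDv setI0.
  have eST : (S :\: T) :|: T = S by rewrite setUC -{1}(setIidPr TS) setID.
  rewrite (bigD1 (S :\: T)) //= big1 => [|A neA].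
    by rewrite dST fscaleE fbasisE eST eqxx mulr1 addr0 mulrC.
  case: ifP => dAT; last by rewrite ffunE mulr0.
  rewrite fscaleE fbasisE; case: eqP => [eS|]; last by rewrite !mulr0.
  by move: neA; rewrite eS setDUl setDv setU0 (setDidPl _) ?eqxx.
rewrite big1 // => A _; case: ifP => _; last by rewrite ffunE mulr0.
rewrite fscaleE fbasisE; case: eqP => [eS|]; last by rewrite !mulr0.
by rewrite eS subsetUr in TS.
Qed.

Definition pairs G := \bigcup_(k in G) pair_set k.

Lemma dzi_pair j k : (dzi j \in pair_set k) = (j == k).
Proof. by rewrite !inE !ord_eqE orbF. Qed.

Lemma dzbi_pair j k : (dzbi j \in pair_set k) = (j == k).
Proof. by rewrite !inE !ord_eqE. Qed.

Lemma dzi_pairs j G : (dzi j \in pairs G) = (j \in G).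
Proof.
apply/bigcupP/idP => [[k kG]|jG]; first by rewrite dzi_pair => /eqP->.
by exists j; rewrite ?dzi_pair.
Qed.

Lemma dzbi_pairs j G : (dzbi j \in pairs G) = (j \in G).
Proof.
apply/bigcupP/idP => [[k kG]|jG]; first by rewrite dzbi_pair => /eqP->.
by exists j; rewrite ?dzbi_pair.
Qed.

Lemma dzi_pairU j k l : (dzi j \in pair_set k :|: pair_set l) = (j == k) || (j == l).
Proof. by rewrite in_setU !dzi_pair. Qed.

Lemma dzbi_pairU j k l : (dzbi j \in pair_set k :|: pair_set l) = (j == k) || (j == l).
Proof. by rewrite in_setU !dzbi_pair. Qed.

Definition in_pairs := (dzi_pairU, dzbi_pairU, dzi_pair, dzbi_pair, dzi_pairs, dzbi_pairs).

Lemma disjoint_pair (k l : 'I_n) : k != l -> [disjoint pair_set k & pair_set l].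
Proof.
move=> nekl; rewrite -setI_eq0; apply/eqP/setP_dz => j;
  by rewrite !in_setI !in_pairs in_set0; case: eqP => // ->; apply: negbTE.
Qed.

(** All dz precede all dzbar: the dz-dz and dzbar-dzbar comparisons give equal signs that cancel,
    and moving dzbar_k past dz_l is the one remaining inversion. *)
Lemma wsign_pair (k l : 'I_n) : k != l -> wsign (pair_set k) (pair_set l) = -1.
Proof.
move=> nekl; have dj m : [disjoint [set dzi m] & [set dzbi m]].
  by rewrite disjoints1 inE dzi_dzbi.
rewrite !(wsignUl _ _ (dj _), wsignUr _ _ (dj _)) !wsign11 /=.
have lt_n (i j : 'I_n) : (i < n + j)%N by rewrite (leq_trans (ltn_ord i)) ?leq_addr.
rewrite ltn_add2l lt_n [(n + l < k)%N]ltnNge (ltnW (lt_n _ _)) /=.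
by case: ifP => _; rewrite ?mulrNN ?mulr1 ?mul1r.
Qed.

Lemma wsign_pairs G l : l \notin G -> wsign (pairs G) (pair_set l) = (-1) ^+ #|G|.
Proof.
move: G; apply: set_indU1 => [|k G kG IH].
  by rewrite /pairs big_set0 wsign0l cards0.
rewrite !inE negb_or => /andP[nelk lG].
rewrite /pairs big_setU1 // wsignUl ?wsign_pair 1?eq_sym //.
  by rewrite -/(pairs G) IH // cardsU1 kG exprS.
rewrite -setI_eq0; apply/eqP/setP_dz => j; rewrite in_setI -/(pairs G) !in_pairs in_set0;
  by case: eqP => // ->; apply: negbTE.
Qed.

Definition pair_free X := forall k, ~~ ((dzi k \in X) && (dzbi k \in X)).

Definition block_sign X G : C := \prod_(k in G) wsign X (pair_set k).

(* The sign makes multiplication by a product of two pairs act on the block coefficients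
   without any sign depending on [X] or [G]. *)
Definition block_coef a X G : C := block_sign X G * a (X :|: pairs G).

(** A coefficient of the product at [X :|: pairs G] comes from deleting two pairs, and these must
    lie in [G]. The unpaired part [X] is thus preserved, which is the block decomposition. *)
Lemma wedge_block_coef a (d : 'I_n -> 'I_n -> C) X G :
  pair_free X -> (forall k, k \in G -> (dzi k \notin X) && (dzbi k \notin X)) ->
  block_coef (wedge a
    (\sum_k \sum_l (d k l *: wedge (fbasis (pair_set k)) (fbasis (pair_set l))))) X G
  = - \sum_(k in G) \sum_(l in G :\ k) d k l * block_coef a X (G :\ k :\ l).
Proof.
move=> freeX XG.
rewrite /block_coef wedge_sumr sum_ffunE mulr_sumr.
rewrite [in RHS]big_mkcond -sumrN; apply: eq_bigr => k _.
rewrite wedge_sumr sum_ffunE mulr_sumr.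
have -> : - (if k \in G then \sum_(l in G :\ k) d k l * block_coef a X (G :\ k :\ l) else 0)
  = \sum_l (if (k \in G) && (l \in G :\ k) then - (d k l * block_coef a X (G :\ k :\ l)) else 0).
  case: (k \in G) => /=; last by rewrite oppr0 big1.
  by rewrite -sumrN -big_mkcond.
apply: eq_bigr => l _; rewrite wedgeZr fscaleE wedge_fbasis.
have [->|nekl] := eqVneq k l.
  rewrite !inE eqxx andbF -setI_eq0 setIid; case: eqP => [/setP/(_ (dzi l))|_].
    by rewrite dzi_pair eqxx inE.
  by rewrite linear0 ffunE !mulr0.
rewrite disjoint_pair // wedgeZr fscaleE wedge_fbasisr wsign_pair //.
(* Since [X] contains no full pair, a pair inside the union has its index in [G]. *)
have -> : (pair_set k :|: pair_set l \subset X :|: pairs G) = (k \in G) && (l \in G :\ k).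
  rewrite subUset in_setD1 eq_sym nekl /=.
  have sub m : (pair_set m \subset X :|: pairs G) = (m \in G).
    apply/idP/idP => [/subsetP sG|mG].
      have := sG (dzi m); have := sG (dzbi m); rewrite !in_pairs eqxx !in_setU !in_pairs.
      have := freeX m; case: (m \in G) => //; rewrite !orbF negb_and.
      by move=> /orP[] /negbTE-> => [_ /(_ isT)|/(_ isT)].
    by apply: subset_dz => j; rewrite in_pairs => /eqP->; rewrite in_setU in_pairs mG orbT.
  by rewrite !sub.
case: ifP => [/andP[kG lGk]|_]; last by rewrite !mulr0.
have [nelk lG] : l != k /\ l \in G by apply/andP; rewrite -in_setD1.
set H := G :\ k :\ l.
have kH : k \notin H by rewrite !inE eqxx andbF.
have lH : l \notin H by rewrite !inE eqxx.
have -> : (X :|: pairs G) :\: (pair_set k :|: pair_set l) = X :|: pairs H.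
  have := XG k kG; have := XG l lG => /andP[lX lX'] /andP[kX kX'].
  apply: setP_dz => j; rewrite in_setD !in_pairs !in_setU !in_pairs !in_setD1;
  (have [->|_] := eqVneq j k; first by rewrite ?(negbTE kX) ?(negbTE kX') /= andbF);
  have [->|_] //= := eqVneq j l; by rewrite ?(negbTE lX) ?(negbTE lX').
have dXH : [disjoint X & pairs H].
  rewrite -setI_eq0; apply/eqP/setP_dz => j; rewrite in_setI !in_pairs in_set0 !in_setD1;
  have [/XG/andP[nX nX']|] := boolP (j \in G); rewrite ?andbF ?(negbTE nX) ?(negbTE nX') //.
rewrite wsignUr ?disjoint_pair // !(wsignUl _ _ dXH) !wsign_pairs //.
have -> : block_sign X G = wsign X (pair_set k) * wsign X (pair_set l) * block_sign X H.
  by rewrite /block_sign (big_setD1 k) //= (big_setD1 l) //= mulrA.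
have := wsign_sqr C X (pair_set k); have := wsign_sqr C X (pair_set l).
have : (-1) ^+ #|H| * (-1) ^+ #|H| = 1 :> C by rewrite -expr2 sqrr_sign.
set e := (-1) ^+ #|H|; set sk := wsign X _; set sl := wsign X _ => ee ssl ssk.
rewrite -/(block_coef a X H) /block_coef.
set c := a _; set t := block_sign X H.
(* The signs against [X] occur once in the wedge and once in [block_sign], the sign against
   [pairs H] once for each deleted pair. What survives is the -1 of [wsign_pair]. *)
transitivity (- (d k l * (t * c)) * (e * e) * (sl * sl) * (sk * sk)); first ring.
by rewrite ee ssl ssk !mulr1.
Qed.

End PairBlocks.

(** * Sums over sets of two and three elements *)

Section SmallSets.
Variable T : finType.
Implicit Types x y z : T.

Lemma setD1_2l x y : x != y -> [set x; y] :\ x = [set y].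
Proof.
move=> nexy; apply/setP => i; rewrite !inE.
by case: eqVneq => // ->; rewrite (negbTE nexy).
Qed.

Lemma setD1_2r x y : x != y -> [set x; y] :\ y = [set x].
Proof. by move=> nexy; rewrite setUC setD1_2l // eq_sym. Qed.

Lemma setD1_3 x y z : x != y -> x != z -> [set x; y; z] :\ x = [set y; z].
Proof.
move=> nexy nexz; apply/setP => i; rewrite !inE.
by case: eqVneq => // ->; rewrite (negbTE nexy) (negbTE nexz).
Qed.

Lemma setD1_3r x y z : x != z -> y != z -> [set x; y; z] :\ z = [set x; y].
Proof.
move=> nexz neyz; apply/setP => i; rewrite !inE.
case: eqVneq => [->|_]; last by rewrite orbF.
by rewrite ![z == _]eq_sym (negbTE nexz) (negbTE neyz).
Qed.

Lemma sum_setD1_2 (V : nmodType) x y (F : T -> {set T} -> V) : x != y ->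
  \sum_(k in [set x; y]) F k ([set x; y] :\ k) = F x [set y] + F y [set x].
Proof.
move=> nexy; rewrite (big_setD1 x) ?set21 //= setD1_2l // big_set1.
by rewrite setD1_2r.
Qed.

Lemma sum_setD1_3 (V : nmodType) x y z (F : T -> {set T} -> V) :
  x != y -> x != z -> y != z ->
  \sum_(k in [set x; y; z]) F k ([set x; y; z] :\ k) =
  F x [set y; z] + (F y [set x; z] + F z [set x; y]).
Proof.
move=> nexy nexz neyz; rewrite (big_setD1 x) ?inE ?eqxx //= setD1_3 //.
rewrite (big_setD1 y) ?set21 //= setD1_2l // big_set1.
have -> : [set x; y; z] :\ y = [set x; z].
  by rewrite (setUC [set x]) setD1_3 // eq_sym.
by rewrite setD1_3r.
Qed.

End SmallSets.

(** * Injectivity in diagonal coordinates *)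

Section StandardCoordinates.
Variables (C : numClosedFieldType) (n : nat).
Local Notation form := (form_t C n).
Local Notation wedge := (@wedge C n).
Local Notation fbasis := (@fbasis C n).
Local Notation dzi := (@dzi n).
Local Notation dzbi := (@dzbi n).
Implicit Types (a f g : form) (S X : {set 'I_(n + n)}) (G : {set 'I_n}).

Variables (p q z : 'I_n -> C) (d : 'I_n -> 'I_n -> C).
Hypothesis p_gt0 : forall i, 0 < p i.
Hypothesis q_real : forall i, q i \is Num.real.
Hypothesis det_gt0 : forall i, 0 < p i * q i - z i * (z i)^*.
Hypothesis dE : forall k l, d k l + d l k = mixdisc p q z k l.

(** Two-forms commute, so only the symmetrization of [d] matters; [dE] identifies it with the mixed
    discriminant. *)
Definition pair_quadric : form :=
  \sum_k \sum_l (d k l *: wedge (fbasis (pair_set k)) (fbasis (pair_set l))).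

Definition avoids k X := (dzi k \notin X) && (dzbi k \notin X).

Lemma block_coef_eq0 a X G : block_coef a X G = 0 -> a (X :|: pairs G) = 0.
Proof.
have nz k : wsign C X (pair_set k) != 0 by rewrite /wsign signr_eq0.
move/eqP; rewrite mulf_eq0 => /orP[|/eqP //].
by rewrite prodf_seq_eq0 => /hasP[k _]; rewrite (negbTE (nz k)) andbF.
Qed.

(** The scalar block: the coefficient at [X] together with the pairs x and y is, up to sign, the
    positive number D(x, y) times [a X]. *)
Lemma quadric_block2 a X x y : wedge a pair_quadric = 0 -> pair_free X -> x != y ->
  avoids x X -> avoids y X -> a X = 0.
Proof.
move=> a0 Xfree nexy xX yX.
have XG k : k \in [set x; y] -> avoids k X by rewrite !inE => /orP[] /eqP->.
have := wedge_block_coef a d Xfree XG; rewrite -/pair_quadric a0.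
rewrite {1}/block_coef ffunE mulr0 => /esym/eqP; rewrite oppr_eq0.
rewrite (sum_setD1_2 (fun k H => \sum_(l in H) d k l * block_coef a X (H :\ l))) //.
rewrite !big_set1 !setDv -mulrDl dE mulf_eq0 (gt_eqF (mixdisc_gt0 p_gt0 det_gt0 _ _)) /=.
by move/eqP/block_coef_eq0; rewrite /pairs big_set0 setU0.
Qed.

(** One row of the 4x4 block: keeping one of three pairs means that the other two were supplied by
    the quadric. *)
Lemma quadric_block3 a X i j k : wedge a pair_quadric = 0 -> pair_free X ->
  i != j -> i != k -> j != k -> avoids i X -> avoids j X -> avoids k X ->
  mixdisc p q z j k * block_coef a X [set i]
  + mixdisc p q z i k * block_coef a X [set j]
  + mixdisc p q z i j * block_coef a X [set k] = 0.
Proof.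
move=> a0 Xfree neij neik nejk iX jX kX.
have XG m : m \in [set i; j; k] -> avoids m X.
  by rewrite !inE => /orP[/orP[]|] /eqP->.
have := wedge_block_coef a d Xfree XG; rewrite -/pair_quadric a0.
rewrite {1}/block_coef ffunE mulr0 => /esym/eqP; rewrite oppr_eq0.
rewrite (sum_setD1_3 (fun m H => \sum_(l in H) d m l * block_coef a X (H :\ l))) //.
rewrite (sum_setD1_2 (fun l H => d i l * block_coef a X H)) //.
rewrite (sum_setD1_2 (fun l H => d j l * block_coef a X H)) //.
rewrite (sum_setD1_2 (fun l H => d k l * block_coef a X H)) //.
by move/eqP <-; rewrite -!dE; ring.
Qed.

Lemma quadric_inj a r s : (r + s + 2 = n)%N -> (minn r s <= 1)%N -> is_pq r s a ->
  wedge a pair_quadric = 0 -> a = 0.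
Proof.
move=> rsn rs1 Ha a0; apply/ffunP => S; rewrite [RHS]ffunE.
apply/eqP; apply/negPn/negP => aS; have [hS hS'] := Ha S aS.
set K := hol_part S :&: ahol_part S.
set N := ~: (hol_part S :|: ahol_part S).
(* [K] holds the indices with both generators in [S], [N] those with neither. The union of the two
   parts has r + s - |K| elements, and n = r + s + 2. *)
have cN : #|N| = #|K|.+2.
  have := cardsC (hol_part S :|: ahol_part S); rewrite -/N card_ord cardsU hS hS' -/K.
  have := subset_leq_card (subsetIl (hol_part S) (ahol_part S)); rewrite -/K hS; lia.
have cK : (#|K| <= 1)%N.
  have := subset_leq_card (subsetIl (hol_part S) (ahol_part S)).
  have := subset_leq_card (subsetIr (hol_part S) (ahol_part S)).
  by rewrite -/K hS hS'; move: rs1; lia.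
have NS k : k \in N -> avoids k S by rewrite /avoids !inE negb_or.
pose X := S :\: pairs K.
have Xfree : pair_free X.
  move=> k; rewrite /X !in_setD !in_pairs !inE.
  by case: (_ \in S); case: (_ \in S); rewrite ?andbF.
have XS k : avoids k S -> avoids k X.
  by rewrite /avoids /X !in_setD => /andP[/negbTE-> /negbTE->]; rewrite !andbF.
have SE : S = X :|: pairs K.
  apply: setP_dz => k; rewrite in_setU in_setD !in_pairs !inE;
    by case: (_ \in S); case: (_ \in S).
have [K0|K1] : #|K| = 0%N \/ #|K| = 1%N by lia.
  have /cards2P[x [y [nexy NE]]] : #|N| == 2 by rewrite cN K0.
  have [xN yN] : x \in N /\ y \in N by rewrite NE set21 set22.
  case/eqP: aS; rewrite SE (cards0_eq K0) /pairs big_set0 setU0.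
  by apply: (quadric_block2 a0 Xfree nexy); apply/XS/NS.
have /cards1P[j KE] : #|K| == 1%N by rewrite K1.
have /card_gt0P[x xN] : (0 < #|N|)%N by rewrite cN.
have /cards2P[y [w [neyw NE]]] : #|N :\ x| == 2.
  by move: cN; rewrite (cardsD1 x) xN K1 add1n => -[->].
have : y \in N :\ x by rewrite NE set21.
rewrite in_setD1 => /andP[neyx yN].
have : w \in N :\ x by rewrite NE set22.
rewrite in_setD1 => /andP[newx wN].
have jK : j \in K by rewrite KE set11.
have nej i : i \in N -> j != i.
  apply: contraTneq => <-; move: jK; rewrite !inE => /andP[-> _] //.
have jX : avoids j X by rewrite /avoids /X !in_setD !in_pairs jK.
have [nexy nexw] : x != y /\ x != w by rewrite ![x == _]eq_sym.
have [xX yX wX] : [/\ avoids x X, avoids y X & avoids w X] by split; apply/XS/NS.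
have B := quadric_block3 a0 Xfree.
case/eqP: aS; rewrite SE KE; apply: block_coef_eq0.
(* The four equations come from the four triples in {j, x, y, w}, each omitting one index; the
   unknown at j is the coefficient of [a] at [S] up to sign. *)
exact: (mixdisc_compl_kernel p_gt0 q_real det_gt0
  (B x y w nexy nexw neyw xX yX wX)
  (B j y w (nej y yN) (nej w wN) neyw jX yX wX)
  (B j x w (nej x xN) (nej w wN) nexw jX xX wX)
  (B j x y (nej x xN) (nej y yN) nexy jX xX yX)).
Qed.

End StandardCoordinates.

(** * From injectivity to bijectivity *)

Section Duality.
Variables (C : numClosedFieldType) (n : nat).
Local Notation form := (form_t C n).
Local Notation wedge := (@wedge C n).
Implicit Types (f g : form) (S : {set 'I_(n + n)}).

(** A plain complement would send type (p, q) to (n-p, n-q); the swap turns this into (n-q, n-p). *)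
Definition conj_compl S : {set 'I_(n + n)} := [set x | swapgen x \notin S].

Lemma swapgen_dzbi (k : 'I_n) : swapgen (dzbi k) = dzi k.
Proof. by rewrite /swapgen (unsplitK (inr k)). Qed.

Lemma conj_complK : involutive conj_compl.
Proof.
by move=> S; apply: setP_dz => k; rewrite !inE ?(swapgen_dzi, swapgen_dzbi) negbK.
Qed.

Lemma hol_conj_compl S : #|hol_part (conj_compl S)| = (n - #|ahol_part S|)%N.
Proof.
rewrite cardsCs card_ord; congr (n - #|pred_of_set _|)%N.
by apply/setP => k; rewrite !inE swapgen_dzi negbK.
Qed.

Lemma ahol_conj_compl S : #|ahol_part (conj_compl S)| = (n - #|hol_part S|)%N.
Proof.
rewrite cardsCs card_ord; congr (n - #|pred_of_set _|)%N.
by apply/setP => k; rewrite !inE swapgen_dzbi negbK.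
Qed.

Variables (Om : form) (p q : nat).

Definition pqb S := (#|hol_part S| == p) && (#|ahol_part S| == q).

(** Acting as the identity on coefficients outside type (p, q) gives an endomorphism of the whole
    space and forces every kernel element into V^{p,q}. *)
Definition lefschetz_endo f : form :=
  [ffun S => if pqb S then wedge f Om (conj_compl S) else f S].

Lemma lefschetz_endoE f S :
  lefschetz_endo f S = if pqb S then wedge f Om (conj_compl S) else f S.
Proof. by rewrite ffunE. Qed.

Lemma lefschetz_endo_linear : linear lefschetz_endo.
Proof.
move=> c f g; apply/ffunP => S; rewrite [RHS]ffunE fscaleE !lefschetz_endoE.
by rewrite wedgeDl wedgeZl; case: ifP => _; rewrite ffunE fscaleE.
Qed.

HB.instance Definition _ :=
  GRing.isLinear.Build C form form *:%R lefschetz_endo lefschetz_endo_linear.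

(* Via S |-> conj_compl S the target V^{n-q,n-p} is identified with V^{p,q}, so that
   surjectivity follows from injectivity of an endomorphism. *)
Lemma lefschetz_of_inj : (p + q + 2 = n)%N -> is_pq 2 2 Om ->
  (forall a : form, is_pq p q a -> wedge a Om = 0 -> a = 0) -> lefschetz Om p q.
Proof.
move=> pqn HOm inj; split; first by lia.
have deg a : is_pq p q a -> is_pq (n - q) (n - p) (wedge a Om).
  move=> Ha; have := is_pq_wedge Ha HOm.
  by have [-> ->] : (n - q = p + 2)%N /\ (n - p = q + 2)%N by lia.
split=> //; split=> [a a' Ha Ha' eqa|b Hb].
  apply/eqP; rewrite -subr_eq0; apply/eqP/inj.
    by rewrite addrC -scaleN1r; apply: is_pqP.
  by rewrite wedgeBl eqa subrr.
have lker : lker (linfun lefschetz_endo) == 0%VS.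
  rewrite -subv0; apply/subvP => f; rewrite memv_ker memv0 lfunE /= => /eqP/ffunP f0.
  have Hf : is_pq p q f.
    move=> S; have := f0 S; rewrite lefschetz_endoE [RHS]ffunE.
    case: ifP => [/andP[/eqP-> /eqP->] //|_ ->].
    by rewrite eqxx.
  apply/eqP/inj => //; apply/ffunP => T; rewrite [RHS]ffunE.
  apply/eqP/negPn/negP => nz; have [hT hT'] := deg f Hf T nz.
  have := f0 (conj_compl T); rewrite lefschetz_endoE [RHS]ffunE /pqb.
  rewrite hol_conj_compl ahol_conj_compl hT hT'.
  rewrite conj_complK !subKn; [|lia..].
  by rewrite !eqxx /= => /eqP; apply/negP.
(* The zero value outside type (p, q) forces the preimage of [b'] into V^{p,q}. *)
pose b' : form := [ffun S => if pqb S then b (conj_compl S) else 0].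
have : b' \in limg (linfun lefschetz_endo) by rewrite lker0_limgf // memvf.
case/memv_imgP => a _; rewrite lfunE /= => /esym/ffunP eqb.
have Ha : is_pq p q a.
  move=> S; have := eqb S; rewrite lefschetz_endoE [RHS]ffunE.
  case: ifP => [/andP[/eqP-> /eqP->] //|_ <-].
  by rewrite eqxx.
exists a; split => //; apply/ffunP => T.
have [[hT hT']|nT] : (#|hol_part T| = (n - q)%N /\ #|ahol_part T| = (n - p)%N) \/
    ~~ ((#|hol_part T| == n - q) && (#|ahol_part T| == n - p))%N.
  by case: eqP => h; case: eqP => h'; [left|right..].
  have := eqb (conj_compl T); rewrite lefschetz_endoE [RHS]ffunE /pqb.
  rewrite hol_conj_compl ahol_conj_compl hT hT'.
  rewrite conj_complK !subKn; [|lia..].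
  by rewrite !eqxx /= => ->.
have out g : is_pq (n - q) (n - p) g -> g T = 0.
  move=> Hg; apply/eqP/negPn/negP => /Hg[h h'].
  by rewrite h h' !eqxx in nT.
by rewrite !out //; apply: deg.
Qed.

End Duality.

(** * The Lefschetz property *)

(** The vectors (1,0) and (0,1) give positive diagonal entries, the reality of the values at (1,1)
    and (i,1) gives [s = r^*], and (-s,p) gives [p] times the determinant. *)
Lemma posdef2 (C : numClosedFieldType) (p q r s : C) :
  (forall x y : C, (x != 0) || (y != 0) ->
    0 < x * x^* * p + x * y^* * r + y * x^* * s + y * y^* * q) ->
  [/\ 0 < p, 0 < q, s = r^* & 0 < p * q - r * s].
Proof.
move=> H.
have p0 : 0 < p.
  have := H 1 0; rewrite oner_eq0 conjC0 conjC1 => /(_ isT).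
  by rewrite !(mulr0, mul0r, mulr1, mul1r, addr0).
have q0 : 0 < q.
  have := H 0 1; rewrite oner_eq0 orbT conjC0 conjC1 => /(_ isT).
  by rewrite !(mulr0, mul0r, mulr1, mul1r, addr0, add0r).
have rp : p^* = p by apply/CrealP/gtr0_real.
have rq : q^* = q by apply/CrealP/gtr0_real.
have real_rs : r^* + s^* = r + s.
  have := H 1 1; rewrite oner_eq0 conjC1 => /(_ isT) /gtr0_real /CrealP.
  rewrite !rmorphD !rmorphM /= !conjC1 rp rq => e.
  apply: (addrI p); apply: (addIr q).
  by move: e; rewrite !mul1r !addrA.
have real_irs : s^* - r^* = r - s.
  have := H 'i 1; rewrite oner_eq0 orbT conjC1 conjCi => /(_ isT) /gtr0_real /CrealP.
  rewrite !rmorphD !rmorphM !rmorphN /= !conjC1 !conjCi rp rq => e.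
  have /mulfI : 'i != 0 :> C by apply: neq0Ci.
  apply; apply: (addrI ('i * - 'i * p)); apply: (addIr q).
  transitivity (- 'i * - - 'i * p + - 'i * 1 * r^* + 1 * - - 'i * s^* + 1 * 1 * q); first by ring.
  by rewrite e; ring.
have two0 : 2%:R != 0 :> C by rewrite pnatr_eq0.
have sE : s = r^*.
  apply: (mulfI two0).
  transitivity ((r + s) - (r - s)); first by ring.
  by rewrite -real_rs -real_irs; ring.
split=> //; have := H (- s) p; rewrite (gt_eqF p0) orbT rp => /(_ isT).
have -> : - s * (- s)^* * p + - s * p * r + p * (- s)^* * s + p * p * q = p * (p * q - r * s).
  by rewrite rmorphN /= sE conjCK; ring.
by rewrite pmulr_rgt0.
Qed.

Section Determinant.
Variables (C : numClosedFieldType) (n : nat).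
Local Notation form := (form_t C n).
Local Notation wedge := (@wedge C n).
Local Notation fbasis := (@fbasis C n).

(** The l-th coefficient of the combination of entries given by theta is the form of the matrix b(l)
    evaluated at theta, and the Kähler condition makes it positive. *)
Lemma griffiths_coef_posdef (M : 'I_2 -> 'I_2 -> form) (A : 'M[C]_n)
    (b : 'I_2 -> 'I_2 -> 'I_n -> C) :
  griffiths_positive M -> A \in unitmx ->
  (forall i j, M i j = \sum_l (b i j l *: kahler_term A l)) ->
  forall l, [/\ 0 < b 0 0 l, 0 < b 1 1 l, b 1 0 l = (b 0 1 l)^* &
    0 < b 0 0 l * b 1 1 l - b 0 1 l * b 1 0 l].
Proof.
move=> [_ [_ HM]] uA ME l; apply: posdef2 => x y xy.
pose th (i : 'I_2) := if i == 0 then x else y.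
have /HM : exists i, th i != 0.
  by case/orP: xy; [exists 0 | exists 1].
have -> : \sum_i \sum_j ((th i * (th j)^*) *: M i j) =
    \sum_l ((\sum_i \sum_j (th i * (th j)^* * b i j l)) *: kahler_term A l).
  under [RHS]eq_bigr => k _ do rewrite scaler_suml.
  rewrite [RHS]exchange_big; apply: eq_bigr => i _.
  under [RHS]eq_bigr => k _ do rewrite scaler_suml.
  rewrite [RHS]exchange_big; apply: eq_bigr => j _.
  by rewrite ME scaler_sumr; apply: eq_bigr => k _; rewrite scalerA.
move/(kahler_coef_gt0 uA)/(_ l).
have ord1E : lift ord0 ord0 = 1 :> 'I_2 by apply/val_inj.
by rewrite !big_ord_recl !big_ord0 ord1E /th /= !addr0 !addrA.
Qed.

Lemma is_pq_det2 (M : 'I_2 -> 'I_2 -> form) :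
  (forall i j, is_pq 1 1 (M i j)) -> is_pq 2 2 (det2 M).
Proof.
move=> HM; rewrite /det2 addrC -scaleN1r.
by apply: is_pqP; apply: (is_pq_wedge (p := 1) (q := 1)).
Qed.

Lemma det2_kahler_term1 (b : 'I_2 -> 'I_2 -> 'I_n -> C) :
  det2 (fun i j => \sum_l (b i j l *: kahler_term 1%:M l)) =
  ('i / 2%:R) ^+ 2 *: pair_quadric (fun k l => b 0 0 k * b 1 1 l - b 0 1 k * b 1 0 l).
Proof.
have prodE (u v : 'I_n -> C) :
    wedge (\sum_l (u l *: kahler_term 1%:M l)) (\sum_l (v l *: kahler_term 1%:M l)) =
    ('i / 2%:R) ^+ 2 *: pair_quadric (fun k l => u k * v l).
  rewrite wedge_suml scaler_sumr; apply: eq_bigr => k _.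
  rewrite wedge_sumr scaler_sumr; apply: eq_bigr => l _.
  rewrite !kahler_term1 !(wedgeZl, wedgeZr) !scalerA; congr (_ *: _).
  by ring.
rewrite /det2 !prodE -scalerBr; congr (_ *: _).
rewrite /pair_quadric -sumrB; apply: eq_bigr => k _.
by rewrite -sumrB; apply: eq_bigr => l _; rewrite scalerBl.
Qed.

Lemma det2_wedge_inj (M : 'I_2 -> 'I_2 -> form) (r s : nat) (a : form) :
  griffiths_positive M -> diagonalized M ->
  (r + s + 2 = n)%N -> (minn r s <= 1)%N -> is_pq r s a ->
  wedge a (det2 M) = 0 -> a = 0.
Proof.
move=> GM [A [b [uA ME]]] rsn rs1 Ha a0.
have pd := griffiths_coef_posdef GM uA ME.
(* This substitution takes [kahler_term A] to [kahler_term 1%:M], hence all entries to standard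
   coordinates at once. *)
pose phi := ext (mxform (coord_mx (invmx A))).
have phiM f g : phi (wedge f g) = wedge (phi f) (phi g).
  exact: ext_wedge (mxform_anti _) f g.
have phi_det : phi (det2 M) = ('i / 2%:R) ^+ 2 *:
    pair_quadric (fun k l => b 0 0 k * b 1 1 l - b 0 1 k * b 1 0 l).
  rewrite -det2_kahler_term1 /det2 /phi linearB /= -/phi !phiM.
  have phiME i j : phi (M i j) = \sum_l (b i j l *: kahler_term 1%:M l).
    rewrite ME /phi linear_sum; apply: eq_bigr => l _.
    by rewrite linearZ_LR /= ext_kahler_term mulmxV.
  by rewrite !phiME.
have phia0 : phi a = 0.
  apply: (@quadric_inj _ _ (b 0 0) (b 1 1) (b 0 1)
    (fun k l => b 0 0 k * b 1 1 l - b 0 1 k * b 1 0 l) _ _ _ _ _ r s) => //.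
  - by move=> l; case: (pd l).
  - by move=> l; case: (pd l) => _ /gtr0_real.
  - by move=> l; case: (pd l) => _ _ <-.
  (* Hermitian symmetry of b(k) and b(l) turns the symmetrized coefficient into the mixed
     discriminant. *)
  - move=> k l; case: (pd k) => _ _ -> _; case: (pd l) => _ _ -> _.
    by rewrite /mixdisc; ring.
  - exact: is_pq_ext.
  have : phi (wedge a (det2 M)) = 0 by rewrite a0 /phi linear0.
  rewrite phiM phi_det wedgeZr => /eqP; rewrite scaler_eq0 expf_eq0 /=.
  rewrite mulf_eq0 invr_eq0 pnatr_eq0 orbF (negbTE (neq0Ci _)) => /eqP //.
have AK : coord_mx (invmx A) *m coord_mx A = 1%:M.
  by rewrite coord_mxM mulVmx // coord_mx1.
by rewrite -[a](ext_mxformK AK) -/phi phia0 linear0.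
Qed.

End Determinant.

Theorem mainTheorem13 (C : numClosedFieldType) (n : nat) (hn : (4 <= n)%N)
  (M : 'I_2 -> 'I_2 -> form_t C n) :
  griffiths_positive M -> diagonalized M ->
  let Om := det2 M in
  [/\ lefschetz Om (n - 2) 0, lefschetz Om (n - 3) 1,
      lefschetz Om 1 (n - 3) & lefschetz Om 0 (n - 2)].
Proof.
move=> GM DM Om; have [pqM _] := GM.
have L p q : (p + q + 2 = n)%N -> (minn p q <= 1)%N -> lefschetz Om p q.
  move=> pqn pq1; apply: lefschetz_of_inj => //; first exact: is_pq_det2.
  by move=> a; apply: det2_wedge_inj.
by split; apply: L; lia.
Qed.
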